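(* Let $N \ge 2$ and $M \ge 1$ be integers. Then there is no interruptible algorithm in the passive setting for obtaining an observation exactly from the common stationary distribution of $M$ independent irreducible aperiodic Markov chains on $N$ states (with possibly different transition matrices). That is, there is no collection of functions $\phi_{k,i}$ ($k\ge 0$, $i\in[N]$) satisfying properties (i), (ii), (iii) and (iv$'$) of the context.
   Context: Write $[N]=\{1,\dots,N\}$. An algorithm is a collection of functions $\phi_{k,i}: ([N]^M)^{k+1} \to [0,1]$, $k \ge 0$, $i\in[N]$, where $\phi_{k,i}(x(0),\dots,x(k))$, with $x(t) = (x_1(t),\dots,x_M(t)) \in [N]^M$, is interpreted as the conditional probability that the algorithm stops by time $k$ and outputs $i$, given that the $M$ observed trajectories through time $k$ are $(x_l(0),\dots,x_l(k))$, $1\le l\le M$. The functions do not depend on the transition matrices or the initial distribution. For a probability distribution $\rho$ on $[N]^M$ and transition matrices $\mathbf{P}^{(1)},\dots,\mathbf{P}^{(M)}$ on $[N]$, with $\mathbf{P}^{(l)} = (p^{(l)}_{ij})$, put $$a_{k,i} := \sum_{x(0),\dots,x(k)\in[N]^M} \rho(x(0)) \left[\prod_{l=1}^M \prod_{t=1}^k p^{(l)}_{x_l(t-1),x_l(t)}\right] \phi_{k,i}(x(0),\dots,x(k)).$$ The required properties are: (i) for all $k\ge 0$ and all $(x(0),\dots,x(k))$: $\sum_{j\in[N]} \phi_{k,j}(x(0),\dots,x(k)) \le 1$; (ii) for all $i\in[N]$ and all infinite sequences $(x(0),x(1),\dots)$ in $[N]^M$, $\phi_{k,i}(x(0),\dots,x(k))$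 is nondecreasing in $k$; and, for all irreducible aperiodic transition matrices $\mathbf{P}^{(1)},\dots,\mathbf{P}^{(M)}$ on $[N]$ (possibly different) having a common stationary distribution $\pi$, and every probability distribution $\rho$ on $[N]^M$: (iii) $\lim_{k\to\infty} \sum_{j\in[N]} a_{k,j} > 0$ (the algorithm stops with positive probability); (iv$'$) for all $i\in[N]$ and all $k\ge 0$: $a_{k,i} = \pi_i \sum_{j\in[N]} a_{k,j}$ (the output is distributed as $\pi$, independently of the stopping time). *)

(* Defs.v *)
From HB Require Import structures.
From mathcomp Require Import all_boot all_order all_algebra.
From mathcomp Require Import all_classical all_reals all_analysis.

Set Implicit Arguments.
Unset Strict Implicit.
Unset Printing Implicit Defensive.

Import Order.TTheory GRing.Theory Num.Theory.
Import numFieldNormedType.Exports.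

Local Open Scope classical_set_scope.
Local Open Scope ring_scope.

Definition is_distribution (R : realType) (T : finType) (mu : T -> R) : Prop :=
  (forall x, 0 <= mu x) /\ \sum_(x : T) mu x = 1.

Definition transition_matrix (R : realType) (N : nat) (P : 'M[R]_N) : Prop :=
  forall i, is_distribution (P i).

Definition irreducible (R : realType) (N : nat) (P : 'M[R]_N) : Prop :=
  forall i j, exists n : nat, 0 < (P ^+ n) i j.

Definition return_time (R : realType) (N : nat) (P : 'M[R]_N) (i : 'I_N) :
    set nat :=
  [set n | (0 < n)%N /\ 0 < (P ^+ n) i i].

(* [d] is the gcd of the (possibly infinite) set of return times to [i]; the
   gcd of the empty set is 0. *)
Definition is_period (R : realType) (N : nat) (P : 'M[R]_N) (i : 'I_N)
    (d : nat) : Prop :=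
  (forall n, return_time P i n -> (d %| n)%N) /\
  (forall e, (forall n, return_time P i n -> (e %| n)%N) -> (e %| d)%N).

Definition aperiodic (R : realType) (N : nat) (P : 'M[R]_N) : Prop :=
  forall i, is_period P i 1.

Definition stationary (R : realType) (N : nat) (P : 'M[R]_N) (pi : 'rV[R]_N) :
    Prop :=
  is_distribution (pi 0) /\ pi *m P = pi.

(* The states 1, ..., N are the elements of ['I_N]; a configuration is the
   joint state, in [N]^M, of the M chains. *)
Definition config (N M : nat) := {ffun 'I_M -> 'I_N}.

(* The observed trajectories (x(0), ..., x(k)): k + 1 configurations. *)
Definition trajectory (N M k : nat) := {ffun 'I_k.+1 -> config N M}.

Definition prefix_of (N M : nat) (x : nat -> config N M) (k : nat) :
    trajectory N M k :=
  [ffun t : 'I_k.+1 => x t].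

(* [phi k i x] is the conditional probability of having stopped by time [k]
   with output [i], given the trajectories [x] through time [k]. *)
Definition algorithm (R : realType) (N M : nat) :=
  forall k : nat, 'I_N -> trajectory N M k -> R.

Definition unit_interval_valued (R : realType) (N M : nat)
    (phi : algorithm R N M) : Prop :=
  forall k i (x : trajectory N M k), 0 <= phi k i x <= 1.

Definition sum_le1 (R : realType) (N M : nat) (phi : algorithm R N M) : Prop :=
  forall k (x : trajectory N M k), \sum_(j < N) phi k j x <= 1.

Definition nondecreasing_in_time (R : realType) (N M : nat)
    (phi : algorithm R N M) : Prop :=
  forall (i : 'I_N) (x : nat -> config N M),
    nondecreasing_seq (fun k => phi k i (prefix_of x k)).

(* The ordinals [widen_ord (leqnSn k) t] and [lift ord0 t] are the times t and
   t + 1, for t = 0, ..., k - 1. *)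
Definition trajectory_prob (R : realType) (N M : nat) (rho : config N M -> R)
    (P : 'I_M -> 'M[R]_N) (k : nat) (x : trajectory N M k) : R :=
  rho (x ord0) *
  \prod_(l < M) \prod_(t < k)
    P l (x (widen_ord (leqnSn k) t) l) (x (lift ord0 t) l).

Definition output_prob (R : realType) (N M : nat) (phi : algorithm R N M)
    (rho : config N M -> R) (P : 'I_M -> 'M[R]_N) (k : nat) (i : 'I_N) : R :=
  \sum_(x : trajectory N M k) trajectory_prob rho P x * phi k i x.

(* The parameters over which a passive algorithm must work: M irreducible
   aperiodic chains with common stationary distribution [pi], started from an
   arbitrary joint distribution [rho]. *)
Definition admissible (R : realType) (N M : nat) (P : 'I_M -> 'M[R]_N)
    (pi : 'rV[R]_N) (rho : config N M -> R) : Prop :=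
  (forall l, [/\ transition_matrix (P l), irreducible (P l), aperiodic (P l)
               & stationary (P l) pi]) /\
  is_distribution rho.

Definition stops_with_positive_prob (R : realType) (N M : nat)
    (phi : algorithm R N M) : Prop :=
  forall P pi rho, admissible P pi rho ->
    exists2 s : R,
      (fun k => \sum_(j < N) output_prob phi rho P k j) @ \oo --> s & 0 < s.

Definition interruptible (R : realType) (N M : nat)
    (phi : algorithm R N M) : Prop :=
  forall P pi rho, admissible P pi rho ->
    forall (i : 'I_N) (k : nat),
      output_prob phi rho P k i =
        pi 0 i * \sum_(j < N) output_prob phi rho P k j.

(* Main.v *)
Require Import Defs.
From HB Require Import structures.
From mathcomp Require Import all_boot all_order all_algebra.
From mathcomp Require Import all_classical all_reals all_analysis.
From mathcomp Require Import ring lra.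

Set Implicit Arguments.
Unset Strict Implicit.
Unset Printing Implicit Defensive.

Import Order.TTheory GRing.Theory Num.Theory.
Import numFieldNormedType.Exports.

(** Interruptibility forces a nonnegative [phi] to vanish identically, and then
    the algorithm never stops.

    Single out the state v = [ord0]. For G > 0 let pi be proportional to
    (G^2, 1, ..., 1). A chain whose jumps across v are slow, of probability
    tau / G from v to each other state and tau * G back, and which is uniform on
    the other states, is reversible for pi. Let the l-th of the M chains have
    speed tau = e ^ (B ^ l), with B = k + 1. The probability of a trajectory x
    of length k with a prescribed start is then a polynomial in e of lowest term
    e ^ W(x), where W(x) = sum_l B ^ l * c_l(x) and c_l(x) counts the crossings
    of v by the l-th chain. The coefficient of that term is K(x) > 0, which does
    not involve G, times a product of ratios g(x_{t+1}) / g(x_t), with g = G at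
    v and g = 1 elsewhere. This product telescopes to the ratio of the end and
    start weights.

    As c_l(x) <= k < B, the number W(x) determines every c_l(x) as a base-B
    digit. The parity of c_l(x) tells whether the l-th chain is at v at time k,
    so W(x) determines the product of the end weights. Take the least w such
    that [phi] is nonzero on some trajectory with that start and W = w. The
    coefficient of e^w in the probability of output i is F(G) * C_i, where F(G) > 0 does not depend
    on i and C_i >= 0 does not depend on G. Since
    pi_v = G^2 * pi_j for j <> v, interruptibility gives C_v = G^2 * C_j; with
    G = 1 and G = 2 this forces C_v = C_j = 0. A sum of nonnegative terms that
    vanishes has only zero terms, so [phi] vanishes on W = w after all
    ([start_output_eq0]).

    Coefficients may be compared because the identity a_v = G^2 * a_j between
    output probabilities holds for infinitely many e, hence between polynomials
    ([output_poly_ratio]). *)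

(** * Polynomials, digits and telescoping *)

Section Preliminaries.
Local Open Scope ring_scope.

Lemma poly_eq_on_interval (R : realFieldType) (p q : {poly R}) (d : R) :
  0 < d -> (forall e, 0 < e < d -> p.[e] = q.[e]) -> p = q.
Proof.
move=> d0 pq; apply/eqP; rewrite -subr_eq0; apply/negPn/negP => nz.
pose s := mkseq (fun m => d / m.+2%:R) (size (p - q)).
have us : uniq s.
  apply/mkseq_uniq => a b /(mulfI (lt0r_neq0 d0)) /invr_inj /eqP.
  by rewrite eqr_nat => /eqP[].
have rs : all (root (p - q)) s.
  apply/allP => _ /mapP[m _ ->]; rewrite rootE hornerD hornerN pq ?subrr //.
  by rewrite divr_gt0 ?ltr0n //= ltr_pdivrMr ?ltr0n // ltr_pMr // ltr1n.
by have := max_poly_roots nz rs us; rewrite size_mkseq ltnn.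
Qed.

Lemma digits_inj (B m : nat) (c d : 'I_m -> nat) :
  (forall i, c i < B)%N -> (forall i, d i < B)%N ->
  (\sum_(i < m) B ^ i * c i = \sum_(i < m) B ^ i * d i)%N -> c =1 d.
Proof.
elim: m c d => [|m IH] c d cB dB; first by move=> _ [].
rewrite !big_ord_recl !expn0 !mul1n.
have shift (f : 'I_m.+1 -> nat) :
    (\sum_(i < m) B ^ (lift ord0 i) * f (lift ord0 i) =
     B * \sum_(i < m) B ^ i * f (lift ord0 i))%N.
  by rewrite big_distrr; apply: eq_bigr => i _ /=; rewrite /bump expnS mulnA.
rewrite !shift => E.
have B0 : (0 < B)%N := leq_ltn_trans (leq0n _) (cB ord0).
have E0 : c ord0 = d ord0.
  have := congr1 (modn^~ B) E; rewrite ![(_ + B * _)%N]addnC ![(B * _)%N]mulnC.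
  by rewrite !modnMDl !modn_small.
move: E; rewrite E0 => /addnI /eqP; rewrite eqn_pmul2l // => /eqP E i.
case: (unliftP ord0 i) => [j ->|->] //.
by apply: (IH (c \o lift ord0) (d \o lift ord0)) E j => t;
  [apply: cB | apply: dB].
Qed.

(** A boolean that changes an even number of times ends where it started. This
    is how the number of crossings of a state reveals whether a walk ends there. *)
Lemma odd_sum_changes (k : nat) (f : 'I_k.+1 -> bool) :
  odd (\sum_(t < k) (f (widen_ord (leqnSn k) t) (+) f (lift ord0 t))) =
  f ord0 (+) f ord_max.
Proof.
elim: k f => [|k IH] f.
  by rewrite big_ord0 (_ : ord_max = ord0) ?addbb //; apply: val_inj.
rewrite big_ord_recl oddD oddb.
have -> : widen_ord (leqnSn k.+1) ord0 = ord0 by apply: val_inj.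
rewrite (eq_bigr (fun t : 'I_k => nat_of_bool
    (f (lift ord0 (widen_ord (leqnSn k) t)) (+)
     f (lift ord0 (lift ord0 t))))); last first.
  by move=> t _; congr (nat_of_bool (f _ (+) _)); apply: val_inj.
rewrite (IH (f \o lift ord0)) /= (_ : lift ord0 ord_max = ord_max); last first.
  exact: val_inj.
by rewrite addbA -(addbA (f ord0)) addbb addbF.
Qed.

Lemma telescope_prod_ord (F : fieldType) (k : nat) (f : 'I_k.+1 -> F) :
  (forall t, f t != 0) ->
  \prod_(t < k) (f (lift ord0 t) / f (widen_ord (leqnSn k) t)) =
  f ord_max / f ord0.
Proof.
elim: k f => [|k IH] f nz.
  by rewrite big_ord0 (_ : ord_max = ord0) ?divff //; apply: val_inj.
rewrite big_ord_recl.
have -> : widen_ord (leqnSn k.+1) ord0 = ord0 by apply: val_inj.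
rewrite (eq_bigr (fun t : 'I_k => f (lift ord0 (lift ord0 t)) /
    f (lift ord0 (widen_ord (leqnSn k) t)))); last first.
  by move=> t _; congr (_ / f _); apply: val_inj.
rewrite (IH (f \o lift ord0)) /=; last by move=> t; apply: nz.
rewrite (_ : lift ord0 ord_max = ord_max); last exact: val_inj.
by rewrite mulrC mulrA divfK.
Qed.

End Preliminaries.

(** * A chain that rarely crosses a given state *)

Section Chain.
Local Open Scope ring_scope.
Variables (R : realType) (n : nat).
Implicit Types (G tau e : R) (i j : 'I_n.+2).

(** The square root of the stationary law, up to normalization: for a chain
    reversible for g^2, writing the transition probabilities as s_ij * g_j / g_i
    with s symmetric makes the g-dependence of a path probability telescope. *)
Definition weight G i : R := if i == ord0 then G else 1.

Definition crosses i j : bool := (i == ord0) (+) (j == ord0).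

(** The law on the states other than [ord0] is kept uniform, so that only the
    crossings of [ord0] have small probability and need counting. *)
Definition chain G tau : 'M[R]_n.+2 := \matrix_(i, j)
  if i == ord0 then
    (if j == ord0 then 1 - n.+1%:R * (tau / G) else tau / G)
  else
    (if j == ord0 then tau * G else (1 - tau * G) / n.+1%:R).

Definition stationary_law G : 'rV[R]_n.+2 :=
  \row_i (weight G i ^+ 2 / (G ^+ 2 + n.+1%:R)).

(** The range of [tau] is chosen to work for both values G = 1 and G = 2 that
    the final comparison uses. *)
Lemma chain_rest_gt0 G tau : 1 <= G <= 2 ->
  0 < tau < (2 * n.+2%:R)^-1 -> 0 < 1 - tau * G /\ 0 < 1 - n.+1%:R * (tau / G).
Proof.
move=> /andP[G1 G2] /andP[t0]; rewrite -[X in _ < X]div1r.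
rewrite ltr_pdivlMr ?mulr_gt0 ?ltr0n // => tn.
have N0 : (0 : R) <= n%:R by rewrite ler0n.
have eN : n.+2%:R = n%:R + 2 :> R by rewrite -addn2 natrD.
have eN1 : n.+1%:R = n%:R + 1 :> R by rewrite -addn1 natrD.
have tN : 0 <= tau * n%:R by rewrite mulr_ge0 // ltW.
rewrite eN in tn; rewrite eN1; split; first by nra.
rewrite mulrA subr_gt0 ltr_pdivrMr ?(lt_le_trans _ G1) //; nra.
Qed.

Lemma chain_gt0 G tau i j : 1 <= G <= 2 -> 0 < tau < (2 * n.+2%:R)^-1 ->
  0 < chain G tau i j.
Proof.
move=> G12 t0; have [h1 h2] := chain_rest_gt0 G12 t0.
case/andP: G12 => G1 _; case/andP: t0 => t0 _.
have G0 : 0 < G by apply: lt_le_trans G1.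
rewrite mxE; case: ifP => _; case: ifP => _ //.
- exact: divr_gt0.
- exact: mulr_gt0.
- by rewrite divr_gt0 ?ltr0n.
Qed.

Lemma sum_ord0_lift (F : 'I_n.+2 -> R) (c : R) :
  (forall i, i != ord0 -> F i = c) -> \sum_i F i = F ord0 + n.+1%:R * c.
Proof.
move=> Fc; rewrite big_ord_recl (eq_bigr (fun=> c)) => [|i _].
  by rewrite sumr_const card_ord mulr_natl.
by rewrite Fc.
Qed.

Lemma chain_transition G tau : 1 <= G <= 2 -> 0 < tau < (2 * n.+2%:R)^-1 ->
  transition_matrix (chain G tau).
Proof.
move=> G12 t0 i; split=> [j|]; first exact/ltW/chain_gt0.
have n0 : n.+1%:R != 0 :> R by rewrite pnatr_eq0.
rewrite (@sum_ord0_lift _ (if i == ord0 then tau / G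
    else (1 - tau * G) / n.+1%:R)).
  rewrite mxE eqxx; case: ifP => _; first by rewrite subrK.
  by rewrite [_ * (_ / _)]mulrCA divff // mulr1 addrC subrK.
by move=> j /negbTE j0; rewrite mxE j0.
Qed.

Lemma stationary_lawP G tau : 1 <= G <= 2 ->
  stationary (chain G tau) (stationary_law G).
Proof.
move=> /andP[G1 _]; have G0 : 0 < G by apply: lt_le_trans G1.
have Z0 : 0 < G ^+ 2 + n.+1%:R by rewrite addr_gt0 ?exprn_gt0 ?ltr0n.
have n0 : n.+1%:R != 0 :> R by rewrite pnatr_eq0.
have Gn0 := lt0r_neq0 G0; have Zn0 := lt0r_neq0 Z0.
split; first split.
- move=> i; rewrite mxE divr_ge0 ?exprn_ge0 ?(ltW Z0) // /weight.
  by case: ifP => _ //; apply: ltW.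
- rewrite (@sum_ord0_lift _ (G ^+ 2 + n.+1%:R)^-1).
    by rewrite mxE /weight eqxx -[X in _ + _ * X]div1r mulrA mulr1 -mulrDl divff.
  by move=> i /negbTE i0; rewrite mxE /weight i0 expr1n div1r.
apply/rowP => j; rewrite !mxE.
rewrite (@sum_ord0_lift _ ((G ^+ 2 + n.+1%:R)^-1 * (if j == ord0 then tau * G
    else (1 - tau * G) / n.+1%:R))).
  rewrite !mxE /weight eqxx; clear -n0 Zn0 Gn0.
  move: (n.+1%:R : R) n0 Zn0 => q q0 Zn0.
  by case: ifP => _; field; rewrite Zn0 ?q0 ?Gn0.
by move=> i /negbTE i0; rewrite !mxE /weight i0 expr1n div1r.
Qed.

Lemma irreducible_gt0 m (P : 'M[R]_m) :
  (forall a b, 0 < P a b) -> irreducible P.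
Proof. by move=> P0 a b; exists 1%N; rewrite expr1. Qed.

Lemma aperiodic_gt0 m (P : 'M[R]_m) :
  (forall a, 0 < P a a) -> aperiodic P.
Proof.
move=> P0 a; split=> [u _|u]; first exact: dvd1n.
by apply; split=> //; rewrite expr1.
Qed.

(** A transition probability at speed tau = X^b, divided by the power of X that
    it carries when the step crosses [ord0]; its constant coefficient is nonzero. *)
Definition step_core G b i j : {poly R} :=
  if i == ord0 then
    (if j == ord0 then 1 - (n.+1%:R / G)%:P * 'X^b else (G^-1)%:P)
  else
    (if j == ord0 then G%:P else (n.+1%:R^-1)%:P * (1 - G%:P * 'X^b)).

Definition step_poly G b i j : {poly R} :=
  'X^(b * crosses i j) * step_core G b i j.

Lemma horner_step_poly G b e i j :
  (step_poly G b i j).[e] = chain G (e ^+ b) i j.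
Proof.
rewrite mxE /step_poly /step_core /crosses.
case: (i == ord0); case: (j == ord0); rewrite /= ?muln0 ?muln1 !hornerE /=.
- by rewrite mulrAC.
- by [].
- by [].
- by rewrite mulrC [G * _]mulrC.
Qed.

(** The part of the constant coefficient of a step that is free of [G]. *)
Definition resting_mass i j : R :=
  if (i != ord0) && (j != ord0) then n.+1%:R^-1 else 1.

Lemma resting_mass_gt0 i j : 0 < resting_mass i j.
Proof. by rewrite /resting_mass; case: ifP; rewrite ?invr_gt0 ?ltr0n. Qed.

Lemma weight_neq0 G i : 0 < G -> weight G i != 0.
Proof. by move=> G0; rewrite /weight; case: ifP; rewrite ?oner_eq0 ?lt0r_neq0. Qed.

Lemma step_core0 G b i j : 0 < G -> (0 < b)%N ->
  (step_core G b i j).[0] = weight G j / weight G i * resting_mass i j.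
Proof.
move=> /lt0r_neq0 G0 b0; rewrite /step_core /weight /resting_mass.
case: (i == ord0); case: (j == ord0); rewrite /= !hornerE //=.
- by rewrite expr0n eqn0Ngt b0 mulr0 subr0 divff.
- by rewrite divr1.
- by rewrite expr0n eqn0Ngt b0 mulr0 subr0 invr1 mul1r mulr1.
Qed.

End Chain.

(** * Comparing the lowest coefficients *)

Section Vanishing.
Local Open Scope ring_scope.
Variables (R : realType) (n M : nat) (phi : algorithm R n.+2 M).
Variables (k : nat) (s : config n.+2 M).
Implicit Types (x y : trajectory n.+2 M k) (i : 'I_n.+2) (G e : R).

Let now (t : 'I_k) : 'I_k.+1 := widen_ord (leqnSn k) t.
Let next (t : 'I_k) : 'I_k.+1 := lift ord0 t.

Definition dirac_at (y : config n.+2 M) : R := (y == s)%:R.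

Lemma dirac_distribution : is_distribution dirac_at.
Proof.
split=> [y|]; first exact: ler0n.
rewrite (bigD1 s) //= /dirac_at eqxx big1 ?addr0 // => y /negbTE -> //.
Qed.

Definition crossings x (l : 'I_M) : nat :=
  (\sum_(t < k) crosses (x (now t) l) (x (next t) l))%N.

(** The order of vanishing of the probability of [x] as the speeds tend to 0.
    The powers of [k.+1] keep the contributions of the chains separate, because
    a chain makes at most [k] crossings by time [k]. *)
Definition valuation x : nat := (\sum_(l < M) k.+1 ^ l * crossings x l)%N.

Definition core_prob G x : {poly R} :=
  \prod_(l < M) \prod_(t < k)
    step_core G (k.+1 ^ l) (x (now t) l) (x (next t) l).

(** Including the initial mass makes trajectories with another start contribute
    0, so that sums may range over all trajectories. *)
Definition start_output i x : R := dirac_at (x ord0) * phi i x.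

Definition output_poly G i : {poly R} :=
  \sum_x (start_output i x)%:P * ('X^(valuation x) * core_prob G x).

Definition slow_chain G e (l : 'I_M) : 'M[R]_n.+2 := chain n G (e ^+ (k.+1 ^ l)).

Lemma slow_chain_admissible G e : 1 <= G <= 2 -> 0 < e < (2 * n.+2%:R)^-1 ->
  admissible (slow_chain G e) (stationary_law n G) dirac_at.
Proof.
move=> G12 e0; split=> [l|]; last exact: dirac_distribution.
have eb : 0 < e ^+ (k.+1 ^ l) < (2 * n.+2%:R)^-1.
  case/andP: e0 => e0 en; rewrite exprn_gt0 //=; apply: (le_lt_trans _ en).
  have e1 : e <= 1.
    apply/ltW/(lt_le_trans en); rewrite invf_le1 ?mulr_gt0 ?ltr0n //.
    by rewrite -natrM ler1n.
  by rewrite -[leRHS]expr1 ler_wiXn2l ?expn_gt0 // ltW.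
have pos := chain_gt0 _ _ G12 eb.
split; [exact: chain_transition | exact: irreducible_gt0 | | exact: stationary_lawP].
exact: aperiodic_gt0.
Qed.

Lemma path_polyE G x : 'X^(valuation x) * core_prob G x =
  \prod_(l < M) \prod_(t < k)
    step_poly G (k.+1 ^ l) (x (now t) l) (x (next t) l).
Proof.
rewrite /valuation expr_sum -big_split; apply: eq_bigr => l _ /=.
by rewrite big_distrr expr_sum -big_split.
Qed.

Lemma horner_output_poly G e i :
  (output_poly G i).[e] = output_prob phi dirac_at (slow_chain G e) k i.
Proof.
rewrite /output_poly horner_sum; apply: eq_bigr => x _.
rewrite hornerM hornerC /start_output /trajectory_prob mulrAC.
congr (_ * _ * _); rewrite path_polyE horner_prod; apply: eq_bigr => l _.
by rewrite horner_prod; apply: eq_bigr => t _; rewrite horner_step_poly.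
Qed.

Definition end_weight G x : R :=
  \prod_(l < M) (weight G (x ord_max l) / weight G (x ord0 l)).

Definition resting_prob x : R :=
  \prod_(l < M) \prod_(t < k) resting_mass R (x (now t) l) (x (next t) l).

Lemma resting_prob_gt0 x : 0 < resting_prob x.
Proof.
by apply: prodr_gt0 => l _; apply: prodr_gt0 => t _; apply: resting_mass_gt0.
Qed.

Lemma end_weight_neq0 G x : 0 < G -> end_weight G x != 0.
Proof.
move=> G0; rewrite prodf_seq_neq0; apply/allP => l _ /=.
by rewrite mulf_neq0 ?invr_neq0 ?weight_neq0.
Qed.

(** Along each trajectory the factors g_j / g_i of the steps telescope. *)
Lemma core_prob0 G x : 0 < G ->
  (core_prob G x)`_0 = end_weight G x * resting_prob x.
Proof.
move=> G0; rewrite -horner_coef0 horner_prod -big_split; apply: eq_bigr => l _ /=.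
rewrite horner_prod -(@telescope_prod_ord _ _ (fun t => weight G (x t l))).
  rewrite -big_split; apply: eq_bigr => t _ /=.
  by rewrite step_core0 // expn_gt0.
by move=> t; apply: weight_neq0.
Qed.

Lemma crossings_lt x l : (crossings x l < k.+1)%N.
Proof.
rewrite ltnS -[leqRHS]card_ord -sum1_card; apply: leq_sum => t _.
exact: leq_b1.
Qed.

Lemma odd_crossings x l :
  odd (crossings x l) = (x ord0 l == ord0) (+) (x ord_max l == ord0).
Proof. exact: (odd_sum_changes (fun t => x t l == ord0)). Qed.

(** The key point: equal valuations mean equal digits, hence equal crossing
    numbers for each chain, hence by parity the same chains sitting at [ord0] at
    the end. *)
Lemma end_weight_valuation G x y :
  x ord0 = y ord0 -> valuation x = valuation y ->
  end_weight G x = end_weight G y.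
Proof.
move=> xy0 /digits_inj E; apply: eq_bigr => l _; rewrite xy0; congr (_ / _).
have := congr1 odd (E (crossings_lt x) (crossings_lt y) l).
by rewrite !odd_crossings xy0 /weight => /addbI ->.
Qed.

Lemma output_poly_lowest G i w : 0 < G ->
  (forall x, (valuation x < w)%N -> start_output i x = 0) ->
  (output_poly G i)`_w = \sum_(x | valuation x == w)
    start_output i x * (end_weight G x * resting_prob x).
Proof.
move=> G0 low; rewrite /output_poly coef_sum [RHS]big_mkcond.
apply: eq_bigr => x _; rewrite coefCM coefXnM.
case: ltngtP => [|/low ->|<-]; first by rewrite mulr0.
  by rewrite mul0r.
by rewrite subnn core_prob0.
Qed.

Hypothesis phi_ge0 : unit_interval_valued phi.
Hypothesis phi_int : interruptible phi.

Lemma start_output_ge0 i x : 0 <= start_output i x.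
Proof. by rewrite mulr_ge0 ?ler0n //; have /andP[] := phi_ge0 i x. Qed.

(** Interruptibility at the stationary law (G^2, 1, ..., 1), valid for all small
    speeds and therefore as an identity of polynomials in the speed. *)
Lemma output_poly_ratio G i : 1 <= G <= 2 -> i != ord0 ->
  output_poly G ord0 = (G ^+ 2)%:P * output_poly G i.
Proof.
move=> G12 /negbTE i0.
apply: (@poly_eq_on_interval _ _ _ (2 * n.+2%:R)^-1) => [|e e0].
  by rewrite invr_gt0 mulr_gt0 ?ltr0n.
rewrite hornerM hornerC !horner_output_poly.
rewrite !(phi_int (slow_chain_admissible G12 e0)) !mxE /weight eqxx i0.
by rewrite expr1n div1r mulrA.
Qed.

(** Strong induction on the valuation: once everything of smaller valuation is
    known to vanish, the coefficient of order [w] of each output probability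
    splits as a nonzero factor shared by all outputs, times a nonnegative number
    [C i] free of [G]. *)
Lemma start_output_eq0 i x : start_output i x = 0.
Proof.
have [w] := ubnP (valuation x); elim: w i x => // w IH i0 x0.
rewrite ltnS leq_eqVlt => /orP[/eqP xw|]; last exact: IH.
have [x0s|x0s] := eqVneq (x0 ord0) s; last first.
  by rewrite /start_output /dirac_at (negbTE x0s) mul0r.
pose C i := \sum_(x | valuation x == w) start_output i x * resting_prob x.
have coefE G i : 0 < G -> (output_poly G i)`_w = end_weight G x0 * C i.
  move=> G0; rewrite (output_poly_lowest G0) => [|x]; last exact: IH.
  rewrite big_distrr; apply: eq_bigr => x /eqP vx /=.
  have [xs|xs] := eqVneq (x ord0) s; last first.
    by rewrite /start_output /dirac_at (negbTE xs) !mul0r mulr0.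
  rewrite mulrCA; congr (_ * _); apply: end_weight_valuation.
    by rewrite xs.
  by rewrite vx.
have ratio G i : 1 <= G <= 2 -> i != ord0 -> C ord0 = G ^+ 2 * C i.
  move=> G12 ni; have G0 : 0 < G by case/andP: G12 => /(lt_le_trans ltr01).
  apply: (mulfI (end_weight_neq0 x0 G0)).
  by rewrite mulrCA -!coefE // -coefCM -output_poly_ratio.
have C0 i : C i = 0.
  (* C ord0 is both C j (G = 1) and 4 * C j (G = 2). *)
  have Cn j : j != ord0 -> C j = 0.
    move=> nj; have := ratio 1 j; have := ratio 2 j.
    rewrite nj !lexx ler1n => /(_ isT isT) -> /(_ isT isT); lra.
  have [->|] := eqVneq i ord0; last exact: Cn.
  by rewrite (ratio 1 ord_max) ?lexx ?ler1n // Cn // mulr0.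
have /eqP := C0 i0; rewrite psumr_eq0 => [/allP /(_ x0)|x _]; last first.
  by rewrite mulr_ge0 ?start_output_ge0 // ltW ?resting_prob_gt0.
rewrite mem_index_enum xw eqxx mulf_eq0 (gt_eqF (resting_prob_gt0 _)) orbF.
by move=> /(_ isT) /eqP.
Qed.

End Vanishing.

(** Every trajectory is reachable when the chains start at its first
    configuration, so vanishing along each deterministic start is vanishing
    everywhere. *)
Lemma interruptible_eq0 (R : realType) (n M : nat) (phi : algorithm R n.+2 M) :
  unit_interval_valued phi -> interruptible phi ->
  forall k i (x : trajectory n.+2 M k), phi k i x = 0%R.
Proof.
move=> phi01 phi_int k i x.
have := start_output_eq0 (x ord0) phi01 phi_int i x.
by rewrite /start_output /dirac_at eqxx mul1r.
Qed.

(** * The impossibility theorem *)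

Theorem theorem6p1 (R : realType) (N M : nat) (hN : (2 <= N)%N)
    (hM : (1 <= M)%N) :
  ~ exists phi : algorithm R N M,
      [/\ unit_interval_valued phi, sum_le1 phi, nondecreasing_in_time phi,
          stops_with_positive_prob phi & interruptible phi].
Proof.
case: N hN => [|[|n]] // _ [phi [phi01 _ _ stops phi_int]].
have phi0 := interruptible_eq0 phi01 phi_int.
(* Any admissible instance contradicts the limit; 1 / (4 (n + 2)) is half of the
   bound on the speed. *)
have adm := @slow_chain_admissible R n M 0 [ffun=> ord0] 1 (4 * n.+2%:R)^-1.
have [||c cvg c0] := stops _ _ _ (adm _ _).
- by rewrite lexx ler1n.
- rewrite invr_gt0 mulr_gt0 ?ltr0n //= ltf_pV2 ?posrE ?mulr_gt0 ?ltr0n //.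
  by rewrite ltr_pM2r ?ltr0n // ltr_nat.
have out0 rho P :
    (fun k => \sum_(j < n.+2) output_prob phi rho P k j)%R = fun=> 0%R.
  apply/funext => k; rewrite big1 // => j _.
  by rewrite /output_prob big1 // => x _; rewrite phi0 mulr0.
move: cvg c0; rewrite out0 => /(cvg_unique _ (cvg_cst _)) <- //.
by rewrite ltxx.
Qed.
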